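(* Let $\mathcal{E}$ be a locally Cartesian closed category, $M:\mathcal{E}\to\mathcal{E}$ a monad, $(\mathbb{T},+,0)$ a monoid in $\mathcal{E}$, and $p$ a polynomial in $\mathcal{E}$. The $pM$-coalgebras with time $\mathbb{T}$ are the objects of a category $\mathbf{Coalg}_M^{\mathbb{T}}(p)$, defined as follows. A morphism $f:(X,\vartheta^o,\vartheta^u)\to(Y,\psi^o,\psi^u)$ is a morphism $f:X\to Y$ in $\mathcal{E}$ such that, for every time $t:\mathbb{T}$ and every global section $\sigma$ of $p$, $$ Mf\circ\vartheta^u(t)\circ\vartheta^o(t)^*\sigma \;=\; \psi^u(t)\circ\psi^o(t)^*\sigma\circ f \;:\; X\to MY .$$ The identity on $(X,\vartheta^o,\vartheta^u)$ is $\mathrm{id}_X$, and composition is composition in $\mathcal{E}$ of the underlying maps of state spaces.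
   Context: $\mathcal{E}$ is thought of as concrete (e.g. $\mathbf{Set}$), and element notation is used. A polynomial in $\mathcal{E}$ is a coproduct of representables $p=\sum_{i:p(1)}y^{p[i]}$, where $y^A=\mathcal{E}(A,-)$; equivalently it is a bundle $\sum_{i:p(1)}p[i]\to p(1)$ in $\mathcal{E}$ with fibres $p[i]$. A (global) section of $p$ is a section $\sigma:p(1)\to\sum_{i:p(1)}p[i]$ of this bundle. $\mathbf{B}\mathbb{T}$ is the one-object category (delooping) of $\mathbb{T}$, and $\mathcal{K}\ell(M)$ is the Kleisli category of $M$. A $pM$-coalgebra with time $\mathbb{T}$ is a triple $\vartheta=(S,\vartheta^o,\vartheta^u)$ with state space $S:\mathcal{E}$, $\vartheta^o:\mathbb{T}\times S\to p(1)$ and $\vartheta^u:\sum_{t:\mathbb{T}}\sum_{s:S}p[\vartheta^o(t,s)]\to MS$, such that for every section $\sigma$ of $p$ the closure $\vartheta^\sigma:\mathbb{T}\times S\to MS$, $\vartheta^\sigma(t):=\vartheta^u(t)\circ\vartheta^o(t)^*\sigma$, constitutes an object of the functor category $\mathbf{Cat}(\mathbf{B}\mathbb{T},\mathcal{K}\ell(M))$; that is, $\vartheta^\sigma(0)$ is the unit $\eta_S$ and $\vartheta^\sigma(s+t)$ is the Kleisli composite of $\vartheta^\sigma(s)$ after $\vartheta^\sigma(t)$. Here $\vartheta^o(t)^*\sigma:S\to\sum_{s:S}p[\vartheta^o(t,s)]$ is $s\mapsto(s,\sigma(\vartheta^o(t,s)))$. *)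

(* Defs.v *)
From Stdlib Require Import ProofIrrelevance.

Set Implicit Arguments.
Unset Strict Implicit.
Unset Printing Implicit Defensive.

Declare Scope cat_scope.
Delimit Scope cat_scope with cat.

Record is_category (Ob : Type) (Hom : Ob -> Ob -> Type)
    (id : forall X, Hom X X)
    (comp : forall X Y Z, Hom Y Z -> Hom X Y -> Hom X Z) : Prop := {
  comp_id_left : forall X Y (f : Hom X Y), comp X Y Y (id Y) f = f;
  comp_id_right : forall X Y (f : Hom X Y), comp X X Y f (id X) = f;
  comp_assoc : forall W X Y Z
    (h : Hom Y Z) (g : Hom X Y) (f : Hom W X),
    comp W X Z (comp X Y Z h g) f = comp W Y Z h (comp W X Y g f)
}.

Record category : Type := {
  object :> Type;
  hom : object -> object -> Type;
  idmap : forall X, hom X X;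
  compose : forall X Y Z, hom Y Z -> hom X Y -> hom X Z;
  category_laws : is_category idmap compose
}.

Arguments hom {c} X Y.
Arguments idmap {c} X.
Arguments compose {c X Y Z} g f.

Notation "g ∘ f" := (compose g f) (at level 40, left associativity) : cat_scope.
Open Scope cat_scope.

Lemma composeA (C : category) (W X Y Z : C)
    (h : hom Y Z) (g : hom X Y) (f : hom W X) : (h ∘ g) ∘ f = h ∘ (g ∘ f).
Proof. apply (comp_assoc (category_laws C)). Qed.

Lemma compose_idl (C : category) (X Y : C) (f : hom X Y) : idmap Y ∘ f = f.
Proof. apply (comp_id_left (category_laws C)). Qed.

Lemma compose_idr (C : category) (X Y : C) (f : hom X Y) : f ∘ idmap X = f.
Proof. apply (comp_id_right (category_laws C)). Qed.

Record is_functor (C D : category) (F : C -> D)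
    (Fmap : forall X Y : C, hom X Y -> hom (F X) (F Y)) : Prop := {
  fmap_id : forall X, Fmap X X (idmap X) = idmap (F X);
  fmap_compose : forall X Y Z (g : hom Y Z) (f : hom X Y),
    Fmap X Z (g ∘ f) = Fmap Y Z g ∘ Fmap X Y f
}.

Record functor (C D : category) : Type := {
  fobj :> C -> D;
  fmap : forall X Y : C, hom X Y -> hom (fobj X) (fobj Y);
  functor_laws : is_functor fmap
}.

Arguments fmap {C D} F {X Y} f : rename.

Record monad (C : category) : Type := {
  monad_functor :> functor C C;
  eta : forall X : C, hom X (monad_functor X);
  mu : forall X : C, hom (monad_functor (monad_functor X)) (monad_functor X);
  eta_natural : forall (X Y : C) (f : hom X Y),
    fmap monad_functor f ∘ eta X = eta Y ∘ f;
  mu_natural : forall (X Y : C) (f : hom X Y),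
    fmap monad_functor f ∘ mu X
    = mu Y ∘ fmap monad_functor (fmap monad_functor f);
  mu_eta_left : forall X : C,
    mu X ∘ eta (monad_functor X) = idmap (monad_functor X);
  mu_eta_right : forall X : C,
    mu X ∘ fmap monad_functor (eta X) = idmap (monad_functor X);
  mu_assoc : forall X : C,
    mu X ∘ mu (monad_functor X) = mu X ∘ fmap monad_functor (mu X)
}.

Arguments eta {C} M X : rename.
Arguments mu {C} M X : rename.

Lemma kleisli_laws (C : category) (M : monad C) :
  @is_category C (fun X Y => hom X (M Y)) (fun X => eta M X)
    (fun X Y Z g f => mu M Z ∘ (fmap M g ∘ f)).
Proof.
split.
- intros X Y f. now rewrite <- composeA, mu_eta_right, compose_idl.
- intros X Y f.
  now rewrite eta_natural, <- composeA, mu_eta_left, compose_idl.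
- intros W X Y Z h g f.
  rewrite !(fmap_compose (functor_laws M)), <- !composeA.
  rewrite <- mu_assoc.
  rewrite (composeA (mu M Z) (mu M (M Z))), <- mu_natural.
  now rewrite <- composeA.
Qed.

Definition kleisli (C : category) (M : monad C) : category :=
  {| category_laws := kleisli_laws M |}.

Record terminal (C : category) : Type := {
  terminal_object :> C;
  bang : forall X : C, hom X terminal_object;
  bang_unique : forall (X : C) (f : hom X terminal_object), f = bang X
}.

Arguments bang {C} t X.

Record product (C : category) (A B : C) : Type := {
  product_object :> C;
  fst_map : hom product_object A;
  snd_map : hom product_object B;
  pair_map : forall Z : C, hom Z A -> hom Z B -> hom Z product_object;
  fst_pair : forall (Z : C) (a : hom Z A) (b : hom Z B),
    fst_map ∘ pair_map a b = a;
  snd_pair : forall (Z : C) (a : hom Z A) (b : hom Z B),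
    snd_map ∘ pair_map a b = b;
  pair_unique : forall (Z : C) (h k : hom Z product_object),
    fst_map ∘ h = fst_map ∘ k -> snd_map ∘ h = snd_map ∘ k -> h = k
}.

Arguments fst_map {C A B} p.
Arguments snd_map {C A B} p.
Arguments pair_map {C A B} p {Z} a b.

Record pullback (C : category) (A B D : C) (f : hom A D) (g : hom B D) : Type := {
  pullback_object :> C;
  pb1 : hom pullback_object A;
  pb2 : hom pullback_object B;
  pb_square : f ∘ pb1 = g ∘ pb2;
  pb_pair : forall (Z : C) (a : hom Z A) (b : hom Z B),
    f ∘ a = g ∘ b -> hom Z pullback_object;
  pb1_pair : forall (Z : C) (a : hom Z A) (b : hom Z B) (e : f ∘ a = g ∘ b),
    pb1 ∘ pb_pair e = a;
  pb2_pair : forall (Z : C) (a : hom Z A) (b : hom Z B) (e : f ∘ a = g ∘ b),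
    pb2 ∘ pb_pair e = b;
  pb_unique : forall (Z : C) (h k : hom Z pullback_object),
    pb1 ∘ h = pb1 ∘ k -> pb2 ∘ h = pb2 ∘ k -> h = k
}.

Arguments pb1 {C A B D f g} p.
Arguments pb2 {C A B D f g} p.
Arguments pb_pair {C A B D f g} p {Z a b} e.

Record exponential (C : category) (prod : forall A B : C, product A B)
    (A B : C) : Type := {
  exponential_object :> C;
  eval : hom (prod exponential_object A) B;
  curry : forall Z : C, hom (prod Z A) B -> hom Z exponential_object;
  eval_curry : forall (Z : C) (f : hom (prod Z A) B),
    eval ∘ pair_map (prod exponential_object A)
             (curry f ∘ fst_map (prod Z A)) (snd_map (prod Z A)) = f;
  curry_unique : forall (Z : C) (f : hom (prod Z A) B)
    (h : hom Z exponential_object),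
    eval ∘ pair_map (prod exponential_object A)
             (h ∘ fst_map (prod Z A)) (snd_map (prod Z A)) = f ->
    h = curry f
}.

Record cartesian_closed (C : category) : Type := {
  cc_terminal : terminal C;
  cc_product : forall A B : C, product A B;
  cc_exponential : forall A B : C, exponential cc_product A B
}.

Section Slice.

Variables (C : category) (X : C).

Record slice_object : Type := {
  slice_dom : C;
  slice_map : hom slice_dom X
}.

Record slice_hom (A B : slice_object) : Type := {
  slice_hom_map : hom (slice_dom A) (slice_dom B);
  slice_triangle : slice_map B ∘ slice_hom_map = slice_map A
}.

Definition slice_id (A : slice_object) : slice_hom A A :=
  {| slice_hom_map := idmap (slice_dom A);
     slice_triangle := compose_idr (slice_map A) |}.

Lemma slice_comp_triangle (A B D : slice_object)
    (g : slice_hom B D) (f : slice_hom A B) :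
  slice_map D ∘ (slice_hom_map g ∘ slice_hom_map f) = slice_map A.
Proof. now rewrite <- composeA, !slice_triangle. Qed.

Definition slice_comp (A B D : slice_object)
    (g : slice_hom B D) (f : slice_hom A B) : slice_hom A D :=
  {| slice_hom_map := slice_hom_map g ∘ slice_hom_map f;
     slice_triangle := slice_comp_triangle g f |}.

Lemma slice_hom_eq (A B : slice_object) (f g : slice_hom A B) :
  slice_hom_map f = slice_hom_map g -> f = g.
Proof.
destruct f as [f ef], g as [g eg]; simpl; intros e; subst g.
now rewrite (proof_irrelevance _ ef eg).
Qed.

Lemma slice_laws : is_category slice_id slice_comp.
Proof.
split; intros; apply slice_hom_eq; simpl.
- apply compose_idl.
- apply compose_idr.
- apply composeA.
Qed.

Definition slice : category := {| category_laws := slice_laws |}.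

End Slice.

(** A terminal object together with the pullbacks gives all finite limits; the
    binary products are a separate field only so that they need not be chosen
    as pullbacks over the terminal object. *)
Record locally_cartesian_closed (C : category) : Type := {
  lcc_terminal : terminal C;
  lcc_product : forall A B : C, product A B;
  lcc_pullback : forall (A B D : C) (f : hom A D) (g : hom B D), pullback f g;
  lcc_slice : forall X : C, cartesian_closed (slice X)
}.

Arguments lcc_pullback {C} l {A B D} f g.

Section Monoid.

Variables (E : category) (L : locally_cartesian_closed E).

Local Notation one := (lcc_terminal L).
Local Notation "A × B" := (lcc_product L A B) (at level 40).
Local Notation pair a b := (pair_map (lcc_product L _ _) a b).
Local Notation fst A B := (fst_map (lcc_product L A B)).
Local Notation snd A B := (snd_map (lcc_product L A B)).

Record monoid : Type := {
  carrier : E;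
  zero : hom one carrier;
  plus : hom (carrier × carrier) carrier;
  plus_zero_left : plus ∘ pair (zero ∘ bang one carrier) (idmap carrier)
                   = idmap carrier;
  plus_zero_right : plus ∘ pair (idmap carrier) (zero ∘ bang one carrier)
                    = idmap carrier;
  plus_assoc :
    plus ∘ pair (plus ∘ fst (carrier × carrier) carrier)
                (snd (carrier × carrier) carrier)
    = plus ∘ pair (fst carrier carrier ∘ fst (carrier × carrier) carrier)
                  (plus ∘ pair (snd carrier carrier
                                ∘ fst (carrier × carrier) carrier)
                               (snd (carrier × carrier) carrier))
}.

Variable T : monoid.

Definition time : Type := hom one (carrier T).

Definition time_plus (s t : time) : time := plus T ∘ pair s t.

Lemma pair_compose (A B Z W : E) (a : hom Z A) (b : hom Z B) (h : hom W Z) :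
  pair a b ∘ h = pair (a ∘ h) (b ∘ h).
Proof.
apply pair_unique.
- now rewrite <- composeA, !fst_pair.
- now rewrite <- composeA, !snd_pair.
Qed.

Lemma bang_one (h : hom one one) : h = idmap one.
Proof. now rewrite (bang_unique h), <- (bang_unique (idmap one)). Qed.

Lemma delooping_laws :
  @is_category unit (fun _ _ => time) (fun _ => zero T)
    (fun _ _ _ => time_plus).
Proof.
unfold time_plus, time; split.
- intros _ _ t.
  assert (e := f_equal (fun h => h ∘ t) (plus_zero_left T)); simpl in e.
  rewrite composeA, pair_compose, composeA, !compose_idl in e.
  now rewrite (bang_one (bang one (carrier T) ∘ t)), compose_idr in e.
- intros _ _ t.
  assert (e := f_equal (fun h => h ∘ t) (plus_zero_right T)); simpl in e.
  rewrite composeA, pair_compose, composeA, !compose_idl in e.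
  now rewrite (bang_one (bang one (carrier T) ∘ t)), compose_idr in e.
- intros _ _ _ _ r s t.
  assert (e := f_equal (fun h => h ∘ pair (pair r s) t) (plus_assoc T)).
  simpl in e.
  rewrite !composeA, !pair_compose, !composeA, !pair_compose, !composeA in e.
  now rewrite ?fst_pair, ?snd_pair, ?fst_pair, ?snd_pair in e.
Qed.

(** The ordinary one-object category whose morphisms are the global elements
    [1 -> T], composed by addition. Times are global elements throughout: for a
    generalized element [t : U -> T] the map [ϑ^σ(t)] has type [U × S -> M S],
    and composing two such maps in the Kleisli category needs a strength on
    [M]. *)
Definition delooping : category := {| category_laws := delooping_laws |}.

End Monoid.

(** The bundle [Σ_{i : p(1)} p[i] -> p(1)] of a polynomial [p]. *)
Record polynomial (E : category) : Type := {
  positions : E;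
  total : E;
  bundle : hom total positions
}.

Record section (E : category) (p : polynomial E) : Type := {
  section_map :> hom (positions p) (total p);
  section_law : bundle p ∘ section_map = idmap (positions p)
}.

Section Coalgebra.

Variables (E : category) (L : locally_cartesian_closed E) (M : monad E)
  (T : monoid L) (p : polynomial E).

Local Notation one := (lcc_terminal L).
Local Notation "A × B" := (lcc_product L A B) (at level 40).

(** [total_along o] is [Σ_{z : Z} p[o(z)]]. *)
Definition total_along (Z : E) (o : hom Z (positions p)) :
    pullback o (bundle p) :=
  lcc_pullback L o (bundle p).

Lemma pull_section_square (Z : E) (o : hom Z (positions p)) (σ : section p) :
  o ∘ idmap Z = bundle p ∘ (σ ∘ o).
Proof. now rewrite <- composeA, section_law, compose_idl, compose_idr. Qed.

(** [o^*σ], that is [z ↦ (z, σ(o(z)))]. *)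
Definition pull_section (Z : E) (o : hom Z (positions p)) (σ : section p) :
    hom Z (total_along o) :=
  pb_pair (total_along o) (pull_section_square o σ).

Section Closure.

Variables (S : E) (o : hom (carrier T × S) (positions p))
  (u : hom (total_along o) (M S)).

(** [s ↦ (t, s)] *)
Definition at_time (t : time T) : hom S (carrier T × S) :=
  pair_map (carrier T × S) (t ∘ bang one S) (idmap S).

Definition output_at (t : time T) : hom S (positions p) := o ∘ at_time t.

Lemma update_at_square (t : time T) :
  o ∘ (at_time t ∘ pb1 (total_along (output_at t)))
  = bundle p ∘ pb2 (total_along (output_at t)).
Proof. rewrite <- composeA; apply pb_square. Qed.

(** The restriction of [u] along
    [Σ_{s : S} p[o(t,s)] -> Σ_{t : T} Σ_{s : S} p[o(t,s)]]. *)
Definition update_at (t : time T) : hom (total_along (output_at t)) (M S) :=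
  u ∘ pb_pair (total_along o) (update_at_square t).

Definition closure (σ : section p) (t : time T) : hom S (M S) :=
  update_at t ∘ pull_section (output_at t) σ.

End Closure.

Record coalgebra : Type := {
  state : E;
  output : hom (carrier T × state) (positions p);
  update : hom (total_along output) (M state);
  closure_functor : forall σ : section p,
    @is_functor (delooping T) (kleisli M) (fun _ => state)
      (fun _ _ t => closure update σ t)
}.

Record coalgebra_hom (X Y : coalgebra) : Type := {
  hom_map : hom (state X) (state Y);
  hom_law : forall (t : time T) (σ : section p),
    fmap M hom_map ∘ update_at (update X) t
      ∘ pull_section (output_at (output X) t) σ
    = update_at (update Y) t
      ∘ pull_section (output_at (output Y) t) σ ∘ hom_map
}.

End Coalgebra.

(* Main.v *)
From Stdlib Require Import ProofIrrelevance.
Require Import Defs.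

(** A morphism of coalgebras is a map of state spaces in [E] satisfying a property: for each [t] and
    [σ], a square between the closures commutes. The category laws are therefore inherited from [E]
    through [coalgebra_hom_eq], once identities and composites are known to satisfy the property.
    Both facts come from functoriality of [M]: identities by [fmap_id], composites by pasting
    squares in [coalgebra_comp_law]. *)

Section CoalgebraCategory.

Context {E : category} {L : locally_cartesian_closed E} {M : monad E}
  {T : monoid L} {p : polynomial E}.

Implicit Types X Y Z : coalgebra M T p.

(** The remaining field [hom_law] is a proposition, so proof irrelevance identifies its two
    proofs. *)
Lemma coalgebra_hom_eq X Y (f g : coalgebra_hom X Y) :
  hom_map f = hom_map g -> f = g.
Proof.
destruct f as [f ef], g as [g eg]; simpl; intros e; subst g.
now rewrite (proof_irrelevance _ ef eg).
Qed.

Lemma coalgebra_id_law X (t : time T) (σ : section p) :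
  fmap M (idmap (state X)) ∘ update_at (update X) t
    ∘ pull_section L (output_at (output X) t) σ
  = update_at (update X) t
    ∘ pull_section L (output_at (output X) t) σ ∘ idmap (state X).
Proof.
now rewrite (fmap_id (functor_laws M)), compose_idl, compose_idr.
Qed.

Definition coalgebra_id X : coalgebra_hom X X :=
  {| hom_map := idmap (state X); hom_law := coalgebra_id_law X |}.

(** Pasting of squares: writing a, b, c for the closures of [X], [Y], [Z] at [t] and [σ], M(g ∘ f) ∘
    a = Mg ∘ Mf ∘ a = Mg ∘ b ∘ f = c ∘ g ∘ f. *)
Lemma coalgebra_comp_law X Y Z (g : coalgebra_hom Y Z) (f : coalgebra_hom X Y)
    (t : time T) (σ : section p) :
  fmap M (hom_map g ∘ hom_map f) ∘ update_at (update X) t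
    ∘ pull_section L (output_at (output X) t) σ
  = update_at (update Z) t
    ∘ pull_section L (output_at (output Z) t) σ ∘ (hom_map g ∘ hom_map f).
Proof.
rewrite <- (composeA _ (hom_map g) (hom_map f)), <- (hom_law g t σ).
rewrite (fmap_compose (functor_laws M)), !composeA.
(* Both sides now start with [fmap M (hom_map g)]; cancelling it leaves the square of [f]. *)
f_equal.
rewrite <- !composeA.
apply hom_law.
Qed.

Definition coalgebra_comp X Y Z (g : coalgebra_hom Y Z)
    (f : coalgebra_hom X Y) : coalgebra_hom X Z :=
  {| hom_map := hom_map g ∘ hom_map f; hom_law := coalgebra_comp_law X Y Z g f |}.

Lemma coalgebra_laws : is_category coalgebra_id coalgebra_comp.
Proof.
split; intros; apply coalgebra_hom_eq; simpl.
- apply compose_idl.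
- apply compose_idr.
- apply composeA.
Qed.

End CoalgebraCategory.

(** The two equations on underlying maps fix every value of [id_coalg] and [comp_coalg], by
    [coalgebra_hom_eq], so the existential describes the intended structure and no other. *)
Theorem proposition2p11 (E : category) (L : locally_cartesian_closed E)
    (M : monad E) (T : monoid L) (p : polynomial E) :
  exists (id_coalg : forall X : coalgebra M T p, coalgebra_hom X X)
         (comp_coalg : forall X Y Z : coalgebra M T p,
            coalgebra_hom Y Z -> coalgebra_hom X Y -> coalgebra_hom X Z),
    (forall X : coalgebra M T p, hom_map (id_coalg X) = idmap (state X)) /\
    (forall (X Y Z : coalgebra M T p)
            (g : coalgebra_hom Y Z) (f : coalgebra_hom X Y),
       hom_map (comp_coalg X Y Z g f) = hom_map g ∘ hom_map f) /\
    is_category id_coalg comp_coalg.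
Proof.
exists coalgebra_id, coalgebra_comp.
split; [reflexivity | split; [reflexivity | exact coalgebra_laws]].
Qed.
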